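(* Let $\Phi$ be a hitting functional, $\Sigma$ a size functional, and let $a>0$ be such that $\Sigma^{-1}([a,\infty))\neq\emptyset$. Let $\vartheta$ be a deviation functional for $\Phi,\Sigma,a$. Then there is an increasing function $f_a=f_{\Phi,\Sigma,a,\vartheta}:[0,\infty)\to[0,1]$ with $f_a(0)=0$ and $f_a(t)>0$ for $t>0$ such that $$\Phi(K)\ge\left(1+f_a(\varepsilon)\right)\tau(\Phi,\Sigma,a)$$ for all $\varepsilon\ge0$ and all $K\in\Sigma^{-1}([a,\infty))$ with $\vartheta(K)\ge\varepsilon$.
   Context: $\mathbb{S}^d$ is the unit sphere in $\mathbb{R}^{d+1}$ ($d\ge2$). $\overline{\mathcal{K}}^d_s$ is the set of spherically convex bodies, i.e. intersections of $\mathbb{S}^d$ with a closed convex cone in $\mathbb{R}^{d+1}$ that is not a linear subspace, endowed with the spherical Hausdorff metric. A hitting functional is a continuous map $\Phi:\overline{\mathcal{K}}^d_s\to[0,\infty)$ such that $\Phi(K)=0$ if and only if $K$ is a one-point set. A size functional is a continuous map $\Sigma:\overline{\mathcal{K}}^d_s\to[0,\infty)$ with $\Sigma\not\equiv0$ and $\Sigma(\{e\})=0$ for all $e\in\mathbb{S}^d$. For $a>0$ with $\Sigma^{-1}([a,\infty))=\{K\in\overline{\mathcal{K}}^d_s:\Sigma(K)\ge a\}\ne\emptyset$, the isoperimetric constant is $\tau(\Phi,\Sigma,a)=\min\{\Phi(K):K\in\overline{\mathcal{K}}^d_s,\Sigma(K)\ge a\}$ (the minimum is attained and positive) and the class of extremal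 bodies is $\mathcal{E}(\Phi,\Sigma,a)=\{K\in\overline{\mathcal{K}}^d_s:\Sigma(K)\ge a,\ \Phi(K)=\tau(\Phi,\Sigma,a)\}$. A deviation functional for $\Phi,\Sigma,a$ is a continuous map $\vartheta:\Sigma^{-1}([a,\infty))\to[0,\infty)$ with $\vartheta(K)=0$ if and only if $K\in\mathcal{E}(\Phi,\Sigma,a)$. *)

(* Defs.v *)
From HB Require Import structures.
From mathcomp Require Import all_boot all_order all_algebra.
From mathcomp Require Import ring lra.
From mathcomp Require Import all_classical all_reals all_analysis.

Set Implicit Arguments.
Unset Strict Implicit.
Unset Printing Implicit Defensive.

Import Order.TTheory GRing.Theory Num.Theory.
Import numFieldNormedType.Exports.

Local Open Scope classical_set_scope.
Local Open Scope ring_scope.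

(* The library norm on ['rV[R]_n] is the sup norm, so the Euclidean inner
   product is introduced here; both norms induce the same topology. *)
Definition dotp (R : realType) (n : nat) (u v : 'rV[R]_n) : R :=
  \sum_(i < n) u 0 i * v 0 i.

Definition sphere (R : realType) (d : nat) : set 'rV[R]_d.+1 :=
  [set u | dotp u u = 1].
Arguments sphere : clear implicits.

Definition sdist (R : realType) (d : nat) (u v : 'rV[R]_d.+1) : R :=
  acos (dotp u v).

(* Nonemptiness excludes the degenerate case [C = set0]. *)
Definition closed_convex_cone (R : realType) (n : nat) (C : set 'rV[R]_n) :=
  [/\ C !=set0, closed C, convex_set C &
      forall (t : R) u, 0 <= t -> C u -> C (t *: u)].

Definition spherically_convex (R : realType) (d : nat)
    (K : set 'rV[R]_d.+1) :=
  exists C : set 'rV[R]_d.+1,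
    [/\ closed_convex_cone C, ~ submod_closed (mem C) & K = C `&` sphere R d].

Record body (R : realType) (d : nat) := Body {
  body_set :> set 'rV[R]_d.+1;
  body_convex : spherically_convex body_set }.

Definition dist_to (R : realType) (d : nat)
    (u : 'rV[R]_d.+1) (A : set 'rV[R]_d.+1) : R :=
  inf [set sdist u v | v in A].

Definition shausdorff (R : realType) (d : nat) (K L : body R d) : R :=
  Num.max (sup [set dist_to u L | u in (K : set _)])
          (sup [set dist_to v K | v in (L : set _)]).

Section metric.
Context (R : realType).

Section dotp_theory.
Context (n : nat).
Implicit Types u v w : 'rV[R]_n.

Lemma dotpC u v : dotp u v = dotp v u.
Proof. by apply: eq_bigr => i _; rewrite mulrC. Qed.

Lemma dotpDl u v w : dotp (u + v) w = dotp u w + dotp v w.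
Proof. by rewrite -big_split; apply: eq_bigr => i _; rewrite !mxE mulrDl. Qed.

Lemma dotpZl (t : R) u v : dotp (t *: u) v = t * dotp u v.
Proof. by rewrite /dotp mulr_sumr; apply: eq_bigr => i _; rewrite !mxE mulrA. Qed.

Lemma dotpDr u v w : dotp w (u + v) = dotp w u + dotp w v.
Proof. by rewrite dotpC dotpDl !(dotpC w). Qed.

Lemma dotpZr (t : R) u v : dotp u (t *: v) = t * dotp u v.
Proof. by rewrite dotpC dotpZl dotpC. Qed.

Lemma dotp_ge0 u : 0 <= dotp u u.
Proof. by apply: sumr_ge0 => i _; rewrite -expr2 sqr_ge0. Qed.

Lemma dotp_eq0 u : dotp u u = 0 -> u = 0.
Proof.
move=> /eqP; rewrite psumr_eq0 => [/allP h|i _]; last by rewrite -expr2 sqr_ge0.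
apply/rowP => i; rewrite mxE; apply/eqP.
by have := h i (mem_index_enum i); rewrite /= -expr2 sqrf_eq0.
Qed.

Lemma dotp_norm_le u (e : R) : 0 <= e -> dotp u u <= e ^+ 2 -> `|u| <= e.
Proof.
move=> e0 ue; rewrite [leLHS]/Num.Def.normr/= mx_normrE.
apply: bigmax_le => // -[i j] _ /=; rewrite [i]ord1.
rewrite -(@ler_pXn2r _ 2)// ?nnegrE// real_normK ?num_real//.
apply: le_trans ue; rewrite /dotp (bigD1 j)//= expr2 lerDl.
by apply: sumr_ge0 => k _; rewrite -expr2 sqr_ge0.
Qed.

Lemma dotp_CS u v : dotp u v ^+ 2 <= dotp u u * dotp v v.
Proof.
have [v0|] := eqVneq (dotp v v) 0.
  move/dotp_eq0: v0 => ->; rewrite -(scale0r 0) !dotpZr; lra.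
move=> v0; have vgt : 0 < dotp v v by rewrite lt_neqAle eq_sym v0 dotp_ge0.
have := dotp_ge0 (dotp v v *: u + (- dotp u v) *: v).
rewrite !(dotpDl, dotpDr, dotpZl, dotpZr) (dotpC v u) => h.
rewrite -subr_ge0 -(pmulr_rge0 _ vgt); lra.
Qed.

End dotp_theory.

Section sdist_theory.
Context (d : nat).
Notation S := (sphere R d).

Lemma dotp_bound u v : S u -> S v -> -1 <= dotp u v <= 1.
Proof.
move=> uS vS; rewrite -ler_norml -(@ler_pXn2r _ 2)// ?nnegrE//.
by rewrite real_normK ?num_real// expr1n (le_trans (dotp_CS _ _))// uS vS mulr1.
Qed.

Lemma sdist_ge0 u v : S u -> S v -> 0 <= sdist u v.
Proof. by move=> uS vS; rewrite acos_ge0// dotp_bound. Qed.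

Lemma sdist_lepi u v : S u -> S v -> sdist u v <= pi.
Proof. by move=> uS vS; rewrite acos_lepi// dotp_bound. Qed.

Lemma cos_sdist u v : S u -> S v -> cos (sdist u v) = dotp u v.
Proof. by move=> uS vS; rewrite acosK// in_itv dotp_bound. Qed.

Lemma sdistC (u v : 'rV[R]_d.+1) : sdist u v = sdist v u.
Proof. by rewrite /sdist dotpC. Qed.

Lemma sdistxx u : S u -> sdist u u = 0.
Proof. by rewrite /sdist => ->; rewrite acos1. Qed.

Lemma sdist_triangle v u w : S u -> S v -> S w ->
  sdist u w <= sdist u v + sdist v w.
Proof.
move=> uS vS wS; have [lepi|/ltW gepi] := leP (sdist u v + sdist v w) pi; last first.
  by apply: le_trans gepi; exact: sdist_lepi.
rewrite leNgt -ltr_cos ?in_itv/= ?lepi ?addr_ge0 ?sdist_ge0 ?sdist_lepi// -leNgt.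
rewrite cosD !cos_sdist// /sdist !sin_acos ?dotp_bound//.
rewrite lerBlDr -lerBlDl -sqrtrM; last first.
  by rewrite subr_ge0; have := dotp_bound uS vS; nra.
apply: le_trans (ler_norm _) _; rewrite -sqrtr_sqr ler_wsqrtr//.
have := dotp_CS (u + (- dotp u v) *: v) (w + (- dotp v w) *: v).
rewrite !(dotpDl, dotpDr, dotpZl, dotpZr) (dotpC v u) (dotpC w v).
rewrite /sphere/= in uS vS wS; rewrite uS vS wS; lra.
Qed.

Lemma sub_body_sphere (K : body R d) : K `<=` S.
Proof. by move=> u; case: K => K [C [c1 c2 KE]] /=; rewrite KE => -[]. Qed.

Lemma body_neq0 (K : body R d) : K !=set0.
Proof.
case: K => K [C [[[u Cu] Ccl Ccvx Ccone] CN KE]] /=; rewrite KE.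
have [v [Cv v0]] : exists v, C v /\ v != 0.
  apply: contrapT => /forallNP CE; apply: CN.
  have {}CE v : C v -> v = 0.
    by move=> Cv; apply: contrapT => /eqP v0; apply: (CE v).
  have C0 : C 0 by rewrite -(scale0r u); exact: Ccone.
  split; first by rewrite inE.
  move=> t x y; rewrite !inE => /CE -> /CE ->.
  by rewrite scaler0 addr0.
have vv : 0 < dotp v v.
  rewrite lt_neqAle dotp_ge0 andbT; apply: contra v0 => /eqP v0.
  by apply/eqP/dotp_eq0.
exists ((Num.sqrt (dotp v v))^-1 *: v); split.
  by apply: Ccone => //; rewrite invr_ge0 sqrtr_ge0.
rewrite /sphere/= dotpZl dotpZr mulrA -expr2 exprVn sqr_sqrtr ?ltW//.
by rewrite mulVf// gt_eqF.
Qed.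

Lemma dist_to_ge0 u (K : body R d) : S u -> 0 <= dist_to u K.
Proof.
move=> uS; apply: lb_le_inf.
  by have [v Kv] := body_neq0 K; exists (sdist u v), v.
by move=> _ [v Kv <-]; rewrite sdist_ge0//; exact: sub_body_sphere Kv.
Qed.

Lemma dist_to_le u v (K : body R d) :
  S u -> body_set K v -> dist_to u K <= sdist u v.
Proof.
move=> uS Kv; apply: ge_inf; last by exists v.
by exists 0 => _ [w Kw <-]; rewrite sdist_ge0//; exact: sub_body_sphere Kw.
Qed.

Lemma le_dist_to u (K : body R d) r :
  (forall v, body_set K v -> r <= sdist u v) -> r <= dist_to u K.
Proof.
move=> rK; apply: lb_le_inf; last by move=> _ [v Kv <-]; exact: rK.
by have [v Kv] := body_neq0 K; exists (sdist u v), v.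
Qed.

Lemma dist_to_has_ubound (K L : body R d) :
  has_ubound [set dist_to u L | u in (K : set _)].
Proof.
exists pi => _ [u Ku <-]; have [v Lv] := body_neq0 L.
have uS := sub_body_sphere Ku; apply: (le_trans (dist_to_le uS Lv)).
by rewrite sdist_lepi//; exact: sub_body_sphere Lv.
Qed.

Lemma dist_to_shausdorff u (K L : body R d) :
  body_set K u -> dist_to u L <= shausdorff K L.
Proof.
move=> Ku; rewrite /shausdorff le_max; apply/orP; left.
by apply: ub_le_sup; [exact: dist_to_has_ubound|exists u].
Qed.

Lemma shausdorffC (K L : body R d) : shausdorff K L = shausdorff L K.
Proof. by rewrite /shausdorff maxC. Qed.

Lemma shausdorff_le (K L : body R d) r :
  (forall u, body_set K u -> dist_to u L <= r) ->
  (forall v, body_set L v -> dist_to v K <= r) ->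
  shausdorff K L <= r.
Proof.
move=> KL LK; rewrite /shausdorff ge_max; apply/andP; split; apply: ge_sup.
- by have [u Ku] := body_neq0 K; exists (dist_to u L), u.
- by move=> _ [u Ku <-]; exact: KL.
- by have [u Lu] := body_neq0 L; exists (dist_to u K), u.
- by move=> _ [u Lu <-]; exact: LK.
Qed.

Lemma shausdorffxx (K : body R d) : shausdorff K K = 0.
Proof.
apply/eqP; rewrite eq_le; apply/andP; split.
  have KK u : body_set K u -> dist_to u K <= 0.
    move=> Ku; have uS := sub_body_sphere Ku.
    by rewrite -(sdistxx uS); exact: dist_to_le.
  exact: shausdorff_le.
have [u Ku] := body_neq0 K; apply: le_trans (dist_to_shausdorff _ Ku).
by rewrite dist_to_ge0//; exact: sub_body_sphere Ku.
Qed.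

Lemma dist_to_triangle u (L M : body R d) : S u ->
  dist_to u M <= dist_to u L + shausdorff L M.
Proof.
move=> uS; rewrite -lerBlDr; apply: le_dist_to => v Lv; rewrite lerBlDr.
have vS := sub_body_sphere Lv.
rewrite -lerBlDl; apply: le_trans (dist_to_shausdorff M Lv).
apply: le_dist_to => w Mw; have wS := sub_body_sphere Mw.
by rewrite lerBlDl (le_trans (dist_to_le uS Mw))// sdist_triangle.
Qed.

Lemma shausdorff_triangle (L K M : body R d) :
  shausdorff K M <= shausdorff K L + shausdorff L M.
Proof.
apply: shausdorff_le => u uK; have uS := sub_body_sphere uK.
  apply: (le_trans (dist_to_triangle L M uS)).
  by rewrite lerD2r dist_to_shausdorff.
apply: (le_trans (dist_to_triangle L K uS)).
by rewrite (shausdorffC L K) addrC lerD2l (shausdorffC L M) dist_to_shausdorff.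
Qed.

Lemma dist_to_le0 u (K : body R d) : S u -> dist_to u K <= 0 -> body_set K u.
Proof.
move=> uS u0; suff : exists C : set 'rV[R]_d.+1,
    [/\ closed C, K `<=` C & C `&` S `<=` K].
  move=> [C [Ccl KC CK]]; apply: CK; split => //; apply: Ccl.
  move=> B /nbhs_ballP[e /= e0 eB].
  have [r [r0 rpi rcos]] : exists r : R,
      [/\ 0 < r, r <= pi & 1 - cos r < e ^+ 2 / 8].
    have : (cos : R -> R) x @[x --> (0 : R)] --> cos (0 : R).
      exact: continuous_cos.
    move=> /cvgrPdist_lt /(_ (e ^+ 2 / 8)).
    rewrite divr_gt0 ?exprn_gt0// => /(_ isT) /nbhs_ballP[r /= r0 rB].
    have m0 : 0 < Num.min (r / 2) pi by rewrite lt_min divr_gt0//= pi_gt0.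
    exists (Num.min (r / 2) pi); split => //; first by rewrite ge_min lexx orbT.
    apply: (le_lt_trans _ (rB (Num.min (r / 2) pi) _)) => /=.
      by rewrite cos0 ler_norm.
    rewrite /ball/= sub0r normrN gtr0_norm//.
    by rewrite (le_lt_trans (_ : _ <= r / 2)) ?ge_min ?lexx//; lra.
  have [v Kv uv] : exists2 v, body_set K v & sdist u v < r.
    apply: contrapT => /forall2NP h.
    have : r <= dist_to u K.
      by apply: le_dist_to => v Kv; case: (h v) => // /negP; rewrite -leNgt.
    by move=> /le_trans /(_ u0); rewrite leNgt r0.
  exists v; split; first exact: KC.
  have vS := sub_body_sphere Kv.
  apply: eB; rewrite -ball_normE /ball_/=.
  apply: (@le_lt_trans _ _ (e / 2)); last lra.
  apply: dotp_norm_le; first lra.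
  have : cos r < dotp u v.
    by rewrite -cos_sdist// ltr_cos ?in_itv/= ?sdist_ge0 ?sdist_lepi// ltW.
  rewrite -[- v]scaleN1r !(dotpDl, dotpDr, dotpZl, dotpZr) (dotpC v u).
  by rewrite /sphere/= in uS vS; rewrite uS vS; lra.
case: (K) => L [C [[C0 Ccl Ccvx Ccone] CN LE]] /=; exists C.
by rewrite LE; split => // x [].
Qed.

Lemma body_inj (K L : body R d) : (K : set _) = L -> K = L.
Proof.
case: K L => [K Kc] [L Lc] /= KL; rewrite KL in Kc *.
by rewrite (Prop_irrelevance Kc Lc).
Qed.

Lemma shausdorff_positivity (K L : body R d) : shausdorff K L = 0 -> K = L.
Proof.
move=> KL0; apply: body_inj; apply/seteqP; split => u Ku.
  apply: dist_to_le0; first exact: sub_body_sphere Ku.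
  by rewrite -KL0 dist_to_shausdorff.
apply: dist_to_le0; first exact: sub_body_sphere Ku.
by rewrite -KL0 shausdorffC dist_to_shausdorff.
Qed.

End sdist_theory.
End metric.

HB.instance Definition _ (R : realType) (d : nat) := gen_eqMixin (body R d).
HB.instance Definition _ (R : realType) (d : nat) := gen_choiceMixin (body R d).
Section body_metric.
Context (R : realType) (d : nat).
Implicit Types K L M : body R d.

Definition body_ball K (e : R) : set (body R d) := [set L | shausdorff K L < e].

Definition body_entourage := entourage_ body_ball.

Definition body_nbhs K := nbhs_ body_entourage K.

HB.instance Definition _ := hasNbhs.Build (body R d) body_nbhs.

Lemma body_ball_center K (e : R) : 0 < e -> body_ball K e K.
Proof. by move=> e0; rewrite /body_ball/= shausdorffxx. Qed.

Lemma body_ball_sym K L (e : R) : body_ball K e L -> body_ball L e K.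
Proof. by rewrite /body_ball/= shausdorffC. Qed.

Lemma body_ball_triangle K L M (e1 e2 : R) :
  body_ball K e1 L -> body_ball L e2 M -> body_ball K (e1 + e2) M.
Proof.
rewrite /body_ball/= => KL LM.
by rewrite (le_lt_trans (shausdorff_triangle L K M))// ltrD.
Qed.

HB.instance Definition _ := @Nbhs_isPseudoMetric.Build R (body R d)
  body_entourage erefl body_ball body_ball_center body_ball_sym
  body_ball_triangle erefl.

Lemma shausdorff_ge0 K L : 0 <= shausdorff K L.
Proof.
have [u Ku] := body_neq0 K; apply: le_trans (dist_to_shausdorff _ Ku).
by rewrite dist_to_ge0//; exact: sub_body_sphere Ku.
Qed.

HB.instance Definition _ := @PseudoMetric_isMetric.Build R (body R d)
  (@shausdorff R d) shausdorff_ge0 (@shausdorff_positivity R d)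
  (fun K e => erefl).

End body_metric.

Definition hitting_functional (R : realType) (d : nat) (Phi : body R d -> R) :=
  [/\ continuous Phi, forall K, 0 <= Phi K &
      forall K, Phi K = 0 <-> exists e, body_set K = [set e]].

Definition size_functional (R : realType) (d : nat) (Sigma : body R d -> R) :=
  [/\ continuous Sigma, forall K, 0 <= Sigma K, exists K, Sigma K != 0 &
      forall K e, body_set K = [set e] -> Sigma K = 0].

Definition superlevel (R : realType) (d : nat) (Sigma : body R d -> R) (a : R) :
  set (body R d) := [set K | a <= Sigma K].

Definition isoperimetric_constant (R : realType) (d : nat)
    (Phi Sigma : body R d -> R) (a : R) : R :=
  inf [set Phi K | K in superlevel Sigma a].

Definition extremal_bodies (R : realType) (d : nat)
    (Phi Sigma : body R d -> R) (a : R) : set (body R d) :=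
  [set K | superlevel Sigma a K /\ Phi K = isoperimetric_constant Phi Sigma a].

(* A functional defined on [superlevel Sigma a] only is represented by a total
   function whose values outside that set are unconstrained. *)
Definition deviation_functional (R : realType) (d : nat)
    (Phi Sigma : body R d -> R) (a : R) (theta : body R d -> R) :=
  [/\ {within superlevel Sigma a, continuous theta},
      forall K, superlevel Sigma a K -> 0 <= theta K &
      forall K, superlevel Sigma a K ->
        (theta K = 0 <-> extremal_bodies Phi Sigma a K)].

(* Main.v *)
Require Import Defs.
From mathcomp Require Import all_boot all_order all_algebra.
From mathcomp Require Import lra.
From mathcomp Require Import all_classical all_reals all_analysis.

Set Implicit Arguments.
Unset Strict Implicit.
Unset Printing Implicit Defensive.

Import Order.TTheory GRing.Theory Num.Theory.
Import numFieldNormedType.Exports.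
Local Open Scope classical_set_scope.
Local Open Scope ring_scope.

(* The space of bodies is compact, because among closed convex cones those that
   are not linear subspaces are characterized by a condition stable under
   limits: the cone contains a unit vector having nonnegative inner product
   with all its elements. Hence [Phi] attains on [Sigma >= a] its minimum [tau],
   which is positive, and on [Sigma >= a, theta >= t] with [t > 0] a minimum
   greater than [tau]. This gives a nondecreasing [m] with values in [0, 1],
   positive on [t > 0], such that [(1 + m t) * tau <= Phi K] whenever
   [theta K >= t]; multiplying [m t] by [t / (1 + t)] makes it strictly
   increasing. *)

(** * Ultrafilters and limits of families of sets *)

Section filter_lemmas.

(** Compactness yields a cluster point, and a cluster point of an ultrafilter is a limit. *)
Lemma ultra_compact_cvg {T : Type} {U : topologicalType} (F : set_system T)
    (A : set U) (f : T -> U) : UltraFilter F -> compact A ->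
  (\forall x \near F, A (f x)) -> exists2 y, A y & f x @[x --> F] --> y.
Proof.
move=> FU Aco FA; have FF := @ultra_proper _ _ FU.
have [y [Ay yF]] := Aco (f @ F) _ FA.
exists y => // B yB; have [//|FNB] := in_ultra_setVsetC (f @^-1` B) FU.
by have [z [NBz Bz]] := yF (~` B) B FNB yB.
Qed.

(** Reduces an estimate uniform in [x] to a single selection: [g t] is taken to be a point violating
    [Q t] whenever one exists. *)
Lemma near_forall_choice {T U : Type} (F : set_system T) (P Q : T -> U -> Prop) :
  Filter F -> (forall t, exists x, P t x) ->
  (forall g, (forall t, P t (g t)) -> \forall t \near F, Q t (g t)) ->
  \forall t \near F, forall x, P t x -> Q t x.
Proof.
move=> FF Pex PQ.
have /choice[g gP] : forall t, exists x, P t x /\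
    (Q t x -> forall y, P t y -> Q t y).
  move=> t; have [h|/existsNP[x /not_implyP[Px NQx]]] :=
    pselect (forall y, P t y -> Q t y); last by exists x.
  by have [x Px] := Pex t; exists x.
have Qg := PQ g (fun t => (gP t).1).
near=> t; apply: (gP t).2; near: t; exact: Qg.
Unshelve. all: by end_near.
Qed.

(** The Kuratowski lower limit of the sets [C t] along [F]. *)
Definition lower_limit {T : Type} {U : topologicalType} (F : set_system T)
    (C : T -> set U) : set U :=
  [set x | forall B, nbhs x B -> \forall t \near F, C t `&` B !=set0].

Lemma lower_limit_closed {T : Type} {U : topologicalType} (F : set_system T)
    (C : T -> set U) : closed (lower_limit F C).
Proof.
move=> x xcl B xB.
have [y [yC yB]] := xcl _ (nbhs_interior xB).
exact: yC.
Qed.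

Lemma cvg_lower_limit {T : Type} {U : topologicalType} (F : set_system T)
    (C : T -> set U) (f : T -> U) (x : U) : Filter F ->
  (\forall t \near F, C t (f t)) -> f t @[t --> F] --> x -> lower_limit F C x.
Proof.
move=> FF FC fx B /fx FB; near=> t; exists (f t); split; near: t => //.
Unshelve. all: by end_near.
Qed.

End filter_lemmas.

(** * Topology of the Euclidean inner product *)

Section euclidean.
Context {R : realType} {n : nat}.
Implicit Types u v x : 'rV[R]_n.

Lemma cvg_dotp {T : Type} {F : set_system T} {FF : Filter F}
    (f g : T -> 'rV[R]_n) u v :
  f t @[t --> F] --> u -> g t @[t --> F] --> v ->
  dotp (f t) (g t) @[t --> F] --> dotp u v.
Proof.
move=> fu gv; apply: cvg_big => [|i _]; first exact: add_continuous.
by apply: cvgM; apply: (@cvg_comp _ _ _ _ (fun M : 'rV[R]_n => M 0 i));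
  [exact: fu|exact: coord_continuous|exact: gv|exact: coord_continuous].
Qed.

Lemma continuous_dotp_shift (w : 'rV[R]_n) :
  continuous (fun u => dotp (u + w) (u + w)).
Proof.
move=> u; have uw : (v + w) @[v --> u] --> u + w.
  exact: (cvgD (@cvg_id _ (nbhs u)) (cvg_cst w)).
exact: (cvg_dotp uw uw).
Qed.

Lemma dotp0l u : dotp 0 u = 0.
Proof. by rewrite -(scale0r u) dotpZl mul0r. Qed.

Lemma dotp_gt0 u : u != 0 -> 0 < dotp u u.
Proof.
move=> u0; rewrite lt_neqAle dotp_ge0 andbT; apply: contra u0 => /eqP u0.
by apply/eqP/dotp_eq0.
Qed.

(** A closed Euclidean ball about [- w]; it is bounded in the sup norm because
    [r <= (1 + |r|)^2]. *)
Lemma compact_dotp_le (w : 'rV[R]_n) (r : R) :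
  compact [set u | dotp (u + w) (u + w) <= r].
Proof.
apply: bounded_closed_compact.
  exists (`|w| + (1 + `|r|)); split; first exact: num_real.
  move=> M wM u /= ur; apply: ltW; apply: le_lt_trans wM.
  have -> : u = - w + (u + w) by rewrite addrC addrK.
  apply: le_trans (ler_normD _ _) _; rewrite normrN lerD2l.
  apply: dotp_norm_le; first by rewrite addr_ge0.
  apply: (le_trans ur); have := ler_norm r; have := normr_ge0 r; nra.
apply: (@preimage_closed _ _ (fun u => dotp (u + w) (u + w)) [set x | x <= r]).
  by move=> u _; exact: continuous_dotp_shift.
exact: closed_le.
Qed.

Definition normalize u := (Num.sqrt (dotp u u))^-1 *: u.

Lemma dotp_normalize u : u != 0 -> dotp (normalize u) (normalize u) = 1.
Proof.
move=> u0; rewrite dotpZl dotpZr mulrA -expr2 exprVn sqr_sqrtr ?dotp_ge0//.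
by rewrite mulVf// gt_eqF// dotp_gt0.
Qed.

Lemma normalize_id u : dotp u u = 1 -> normalize u = u.
Proof. by move=> uE; rewrite /normalize uE sqrtr1 invr1 scale1r. Qed.

Lemma cvg_normalize u : u != 0 -> normalize v @[v --> u] --> normalize u.
Proof.
move=> u0; suff : (Num.sqrt (dotp v v))^-1 @[v --> u] --> (Num.sqrt (dotp u u))^-1.
  by move=> /cvgZ; apply; exact: (@cvg_id _ (nbhs u)).
apply: (@cvgV _ _ (nbhs u) _ (fun v => Num.sqrt (dotp v v))).
  by rewrite sqrtr_eq0 -ltNge dotp_gt0.
apply: (@cvg_comp _ _ _ (fun v => dotp v v) Num.sqrt); last exact: sqrt_continuous.
exact: (cvg_dotp (@cvg_id _ (nbhs u)) (@cvg_id _ (nbhs u))).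
Qed.

End euclidean.

(** * Closed convex cones *)

Section cones.
Context {R : realType} {n : nat}.
Implicit Types (C : set 'rV[R]_n) (u v x : 'rV[R]_n).

(** The sum is twice the midpoint. *)
Lemma closed_convex_coneD C u v : closed_convex_cone C ->
  C u -> C v -> C (u + v).
Proof.
move=> [_ _ Ccvx Ccone] Cu Cv.
have h0 : 0 <= 2^-1 :> R by rewrite invr_ge0.
have h1 : 2^-1 <= 1 :> R by lra.
have := Ccone 2 _ (ler0n _ _)
  (set_mem (@Ccvx u v (Itv01 h0 h1) (mem_set Cu) (mem_set Cv))).
rewrite /conv/= scalerDr !scalerA /unstable.onem.
have -> : 1 - 2^-1 = 2^-1 :> R by lra.
by rewrite divff ?pnatr_eq0// !scale1r.
Qed.

Lemma closed_convex_cone0 C : closed_convex_cone C -> C 0.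
Proof. by move=> [[u Cu] _ _ Ccone]; rewrite -(scale0r u); exact: Ccone. Qed.

Lemma closed_convex_coneP C : closed C -> C 0 ->
  (forall u v, C u -> C v -> C (u + v)) ->
  (forall (t : R) u, 0 <= t -> C u -> C (t *: u)) -> closed_convex_cone C.
Proof.
move=> Ccl C0 CD CZ; split => //; first by exists 0.
move=> u v t /set_mem Cu /set_mem Cv; apply/mem_set/CD; apply: CZ => //.
by rewrite subr_ge0.
Qed.

(** Sums and nonnegative multiples pass to the limit by continuity of the operations. *)
Lemma lower_limit_cone {T : Type} (F : set_system T) (C : T -> set 'rV[R]_n) :
  Filter F -> (forall t, closed_convex_cone (C t)) ->
  closed_convex_cone (lower_limit F C).
Proof.
move=> FF CC; apply: closed_convex_coneP.
- exact: lower_limit_closed.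
- have C0 : \forall t \near F, C t 0.
    by apply: filterE => t; exact: closed_convex_cone0.
  exact: (@cvg_lower_limit _ _ F C (fun=> 0) 0 FF C0 (cvg_cst _)).
- move=> u v uC vC B uvB.
  have [[B1 B2] /= [uB1 vB2] B12] := @add_continuous 'rV[R]_n (u, v) _ uvB.
  near=> t.
  have [x [Cx Bx]] : C t `&` B1 !=set0 by near: t; exact: uC.
  have [y [Cy By]] : C t `&` B2 !=set0 by near: t; exact: vC.
  exists (x + y); split; first exact: closed_convex_coneD.
  exact: (B12 (x, y)).
- move=> t u t0 uC B tuB.
  have uB : nbhs u [set x | B (t *: x)] := @scaler_continuous R 'rV[R]_n t u _ tuB.
  near=> s.
  have [x [Cx Bx]] : C s `&` [set x | B (t *: x)] !=set0 by near: s; exact: uC.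
  by exists (t *: x); split => //; case: (CC s) => _ _ _; exact.
Unshelve. all: by end_near.
Qed.

(* If [w] is in [C] but [- w] is not and [p] is the point of [C] closest to
   [- w], then [p + w] is the sought vector, up to normalization. *)
Lemma cone_not_subspace C : closed_convex_cone C -> ~ submod_closed (mem C) ->
  exists u, [/\ C u, dotp u u = 1 & forall v, C v -> 0 <= dotp u v].
Proof.
move=> CC CN; have [_ Ccl _ Ccone] := CC; have C0 := closed_convex_cone0 CC.
(* A closed convex cone stable under negation would be a subspace. *)
have [w [Cw CNw]] : exists w, C w /\ ~ C (- w).
  apply: contrapT => /forallNP h.
  have {}h w : C w -> C (- w).
    by move=> Cw; apply: contrapT => CNw; exact: (h w).
  apply: CN; split; first by rewrite inE.
  move=> a u v; rewrite !inE => Cu Cv; apply: closed_convex_coneD => //.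
  have [a0|/ltW a0] := leP 0 a; first exact: Ccone.
  by rewrite -(opprK a) scaleNr -scalerN; apply: Ccone (h _ Cu); rewrite oppr_ge0.
pose g u := dotp (u + w) (u + w).
(* Keeping only points no farther from [- w] than [0] makes the domain compact without changing the
   minimum. *)
have [p] : exists2 p, p \in [set u | g u <= g 0] `&` C &
    forall t, t \in [set u | g u <= g 0] `&` C -> g p <= g t.
  apply: compact_EVT_min.
  - by exists 0; split => /=.
  - exact: (compact_closedI (@compact_dotp_le R n w (g 0)) Ccl).
  - by apply: continuous_subspaceT; exact: continuous_dotp_shift.
rewrite inE => -[/= gp Cp] pmin.
have {}pmin u : C u -> g p <= g u.
  move=> Cu; have [gu|/ltW gu] := leP (g u) (g 0); last exact: le_trans gu.
  by apply: pmin; rewrite inE.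
have pw0 : p + w != 0.
  by apply/eqP => pw; apply: CNw; rewrite -[- w]add0r -pw addrK.
have pwC v : C v -> 0 <= dotp (p + w) v.
  move=> Cv; rewrite leNgt; apply/negP => c0.
  have v0 : v != 0.
    by apply/eqP => v0; move: c0; rewrite v0 dotpC dotp0l ltxx.
  have vv := dotp_gt0 v0.
  (* This [t] minimizes the squared distance from [p + t *: v] to [- w], and that minimum lies
     strictly below [g p]. *)
  pose t := - dotp (p + w) v / dotp v v.
  have t0 : 0 < t by rewrite divr_gt0// oppr_gt0.
  have tv : t * dotp v v = - dotp (p + w) v by rewrite divfK// gt_eqF.
  have tc : t * dotp (p + w) v < 0 by rewrite pmulr_rlt0.
  have := pmin (p + t *: v) (closed_convex_coneD CC Cp (Ccone _ _ (ltW t0) Cv)).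
  rewrite /g addrAC; move: (p + w) tv tc => q tv tc.
  by rewrite !(dotpDl, dotpDr, dotpZl, dotpZr) (dotpC v q) tv; lra.
exists (normalize (p + w)); split.
- by apply: Ccone; [rewrite invr_ge0 sqrtr_ge0|exact: closed_convex_coneD].
- exact: dotp_normalize.
- by move=> v Cv; rewrite dotpZl mulr_ge0 ?invr_ge0 ?sqrtr_ge0 ?pwC.
Qed.

End cones.

(** * Compactness of the space of bodies *)

Section body_compactness.
Context {R : realType} {d : nat}.
Implicit Types (K L : body R d) (u v x : 'rV[R]_d.+1).

Lemma sphere_compact : compact (sphere R d).
Proof.
have Scl : closed (sphere R d).
  apply: (@preimage_closed _ _ (fun u => dotp u u) [set x | x = 1]).
    by move=> u _; exact: (cvg_dotp (@cvg_id _ (nbhs u)) (@cvg_id _ (nbhs u))).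
  exact: closed_eq.
have SB : sphere R d `<=` [set u | dotp (u + 0) (u + 0) <= 1].
  by move=> u /= Su; rewrite addr0 Su.
exact: (subclosed_compact Scl (@compact_dotp_le R d.+1 0 1) SB).
Qed.

(** The cosine turns the bound into one on the continuous [dotp]; truncating [r] at [pi] stays where
    the cosine is decreasing. *)
Lemma near_sdist_lt u (r : R) : sphere R d u -> 0 < r ->
  \forall v \near u, sphere R d v -> sdist u v < r.
Proof.
move=> Su r0; pose s := Num.min r pi.
have s0 : 0 < s by rewrite lt_min r0 pi_gt0.
have spi : s <= pi by rewrite ge_min lexx orbT.
have cs : cos s < dotp u u.
  by rewrite Su -cos0 ltr_cos ?in_itv/= ?lexx ?pi_ge0 ?(ltW s0).
have ucs := cvgr_gt _ (cvg_dotp (cvg_cst u) (@cvg_id _ (nbhs u))) _ cs.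
near=> v => Sv; have : cos s < dotp u v by near: v; exact: ucs.
rewrite -cos_sdist// ltr_cos ?in_itv/= ?sdist_ge0 ?sdist_lepi ?(ltW s0)//.
by rewrite lt_min => /andP[].
Unshelve. all: by end_near.
Qed.

(** Vectors of a cone close to [u] may lie off the sphere; normalizing them keeps them close to
    [u]. *)
Lemma near_sdist_normalize_lt u (r : R) : sphere R d u -> 0 < r ->
  \forall v \near u, v != 0 /\ sdist u (normalize v) < r.
Proof.
move=> Su r0.
have u0 : u != 0.
  apply/eqP => u0; move: Su.
  by rewrite u0 /sphere/= dotp0l => /eqP; rewrite eq_sym oner_eq0.
have nv := cvg_normalize u0; rewrite normalize_id// in nv.
have vv : \forall v \near u, 0 < dotp v v.
  apply: (cvgr_gt _ (cvg_dotp (@cvg_id _ (nbhs u)) (@cvg_id _ (nbhs u)))).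
  by rewrite dotp_gt0.
have nr := nv _ (near_sdist_lt Su r0).
near=> v.
have v0 : v != 0.
  have : 0 < dotp v v by near: v; exact: vv.
  by apply: contraTN => /eqP ->; rewrite dotp0l ltxx.
split => //; have : sphere R d (normalize v) -> sdist u (normalize v) < r.
  by near: v; exact: nr.
by apply; exact: dotp_normalize.
Unshelve. all: by end_near.
Qed.

(* An ultrafilter of bodies converges to the trace on the sphere of the lower
   limit [D] of the cones. The vectors given by [cone_not_subspace] converge
   to a vector of [D] with the same property, so [D] is not a subspace. *)
Lemma body_compact : compact [set: body R d].
Proof.
rewrite compact_ultra => F FU _; have FF := @ultra_proper _ _ FU.
have /choice[C CP] : forall K, exists C : set 'rV[R]_d.+1,
    [/\ closed_convex_cone C, ~ submod_closed (mem C) &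
        body_set K = C `&` sphere R d] := @body_convex R d.
have /choice[e eP] : forall K, exists u,
    [/\ C K u, dotp u u = 1 & forall v, C K v -> 0 <= dotp u v].
  by move=> K; have [CC CN _] := CP K; exact: cone_not_subspace.
pose D := lower_limit F C.
have DC : closed_convex_cone D.
  by apply: lower_limit_cone => K; have [] := CP K.
have [u Su eu] : exists2 u, sphere R d u & e K @[K --> F] --> u.
  apply: (ultra_compact_cvg FU sphere_compact).
  by apply: filterE => K; have [] := eP K.
have Du : D u.
  have Ce : \forall K \near F, C K (e K) by apply: filterE => K; have [] := eP K.
  exact: (@cvg_lower_limit _ _ F C e u FF Ce eu).
(* A negative product would persist near [(u, v)], hence for [e K] and some [w] in [C K], against
   the choice of [e]. *)
have uD v : D v -> 0 <= dotp u v.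
  move=> Dv; rewrite leNgt; apply/negP => uv0.
  have [[B1 B2] /= [B1u B2v] B12] :=
    cvgr_lt _ (cvg_dotp (@cvg_fst _ _ (nbhs u) (nbhs v) _)
                        (@cvg_snd _ _ (nbhs u) (nbhs v) _)) _ uv0.
  have eB1 : F [set K | B1 (e K)] := eu _ B1u.
  have [K [/= Be [w [Cw Bw]]]] := filter_ex (filterI eB1 (Dv _ B2v)).
  have [_ _ /(_ _ Cw)] := eP K.
  by rewrite leNgt (B12 (e K, w)).
(* A subspace would contain [- u], whose product with [u] is [-1]. *)
have DN : ~ submod_closed (mem D).
  move=> [D0 /(_ (-1) u 0)]; rewrite !inE in D0 * => /(_ Du D0)/uD.
  by rewrite addr0 dotpZr Su mulr1 oppr_ge0 ler10.
pose K : body R d := Body (ex_intro _ D (And3 DC DN erefl)).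
have Kco : compact (body_set K).
  rewrite [body_set K]setIC.
  exact: (compact_closedI sphere_compact (@lower_limit_closed _ _ F C)).
exists K; split => // A /nbhs_ballP[r /= r0 rA].
change (\forall L \near F, A L).
have r2 : 0 < r / 2 by rewrite divr_gt0.
have r4 : 0 < r / 4 by rewrite divr_gt0.
(* A selection [g L] in [K] converges to some [x] in [K], and [x] is approximated by normalized
   vectors of [C L]; each error is below [r / 4]. *)
have KL : F [set L : body R d | forall x, body_set K x -> dist_to x L <= r / 2].
  apply: near_forall_choice => [_|g Kg]; first exact: body_neq0.
  have [x [Dx Sx] gx] : exists2 x, body_set K x & g L @[L --> F] --> x.
    by apply: (ultra_compact_cvg FU Kco); apply: filterE => L; exact: Kg.
  have gr : F [set L | sphere R d (g L) -> sdist x (g L) < r / 4] :=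
    gx _ (near_sdist_lt Sx r4).
  apply: filterS2 gr (Dx _ (near_sdist_normalize_lt Sx r4)).
  move=> L /= gr [v [Cv [v0 vr]]].
  have Sg := sub_body_sphere (Kg L).
  have [[_ _ _ CZ] _ LE] := CP L.
  have Sv : sphere R d (normalize v) by exact: dotp_normalize.
  have Lv : body_set L (normalize v).
    by rewrite LE; split => //; apply: CZ => //; rewrite invr_ge0 sqrtr_ge0.
  have := dist_to_le Sg Lv; have := sdist_triangle Sg Sx Sv.
  rewrite (sdistC (g L) x); have := gr Sg; lra.
(* A selection [g L] in [L] converges on the sphere; its limit lies in [D], hence in [K]. *)
have LK : F [set L : body R d | forall x, body_set L x -> dist_to x K <= r / 2].
  apply: near_forall_choice => [L|g Lg]; first exact: body_neq0.
  have Sg L := sub_body_sphere (Lg L).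
  have [x Sx gx] : exists2 x, sphere R d x & g L @[L --> F] --> x.
    by apply: (ultra_compact_cvg FU sphere_compact); exact: filterE.
  have Cg : \forall L \near F, C L (g L).
    by apply: filterE => L; have := Lg L; have [_ _ ->] := CP L => -[].
  have Kx : body_set K x.
    by split => //; exact: (@cvg_lower_limit _ _ F C g x FF Cg gx).
  have gr : F [set L | sphere R d (g L) -> sdist x (g L) < r / 2] :=
    gx _ (near_sdist_lt Sx r2).
  apply: filterS gr => L /= gr.
  by rewrite (le_trans (dist_to_le (Sg L) Kx))// sdistC ltW// gr.
near=> L; apply: rA; rewrite /ball/= /body_ball/=.
apply: (@le_lt_trans _ _ (r / 2)); last by lra.
by apply: shausdorff_le; near: L.
Unshelve. all: by end_near.
Qed.

End body_compactness.

(** * Minimization over superlevel sets *)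

Section deviation.
Context {R : realType} {d : nat}.
Implicit Types Phi Sigma theta : body R d -> R.

Lemma superlevel_closed Sigma a : size_functional Sigma ->
  closed (superlevel Sigma a).
Proof.
move=> [Sc _ _ _].
apply: (@preimage_closed _ _ Sigma [set x | a <= x]); last exact: closed_ge.
by move=> K _; exact: Sc.
Qed.

(** [theta] is continuous only on the superlevel set, but that set is closed, so its relatively
    closed subsets are closed. *)
Lemma deviation_ge_compact Phi Sigma a theta t : size_functional Sigma ->
  deviation_functional Phi Sigma a theta ->
  compact (superlevel Sigma a `&` [set K | t <= theta K]).
Proof.
move=> hSigma [thc _ _]; have Scl := @superlevel_closed Sigma a hSigma.
have Acl : closed (superlevel Sigma a `&` [set K | t <= theta K]).
  rewrite closed_setSI//.
  by move: thc => /continuous_closedP/(_ [set x | t <= x]); apply; exact: closed_ge.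
exact: (subclosed_compact Acl body_compact (@subsetT _ _)).
Qed.

(** By compactness [Phi] has a minimizer; there [Sigma >= a > 0], so it is not a one-point set and
    [Phi] is positive. *)
Lemma isoperimetric_constant_min Phi Sigma a : hitting_functional Phi ->
  size_functional Sigma -> 0 < a -> superlevel Sigma a !=set0 ->
  0 < isoperimetric_constant Phi Sigma a /\
  forall K, superlevel Sigma a K -> isoperimetric_constant Phi Sigma a <= Phi K.
Proof.
move=> [Phic Phi0 Phi1] hSigma a0 Sne.
have tau_le K : superlevel Sigma a K -> isoperimetric_constant Phi Sigma a <= Phi K.
  by move=> SK; apply: ge_inf; [exists 0 => _ [L _ <-]|exists K].
split => //.
have Sco : compact (superlevel Sigma a).
  exact: (subclosed_compact (@superlevel_closed Sigma a hSigma) body_compact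
    (@subsetT _ _)).
have [K] := compact_EVT_min Sne Sco (continuous_subspaceT Phic).
rewrite inE => SK Kmin.
have PhiK : 0 < Phi K.
  rewrite lt_neqAle Phi0 andbT eq_sym; apply/eqP => /Phi1[e Ke].
  have [_ _ _ /(_ K e Ke) SK0] := hSigma.
  by move: SK; rewrite /superlevel/= SK0 leNgt a0.
apply: (lt_le_trans PhiK); apply: lb_le_inf.
  by exists (Phi K), K.
by move=> _ [L SL <-]; apply: Kmin; rewrite inE.
Qed.

End deviation.

(** * Construction of the stability function *)

Theorem proposition3p1 (R : realType) (d : nat) (hd : (2 <= d)%N)
    (Phi Sigma : body R d -> R) (a : R) (theta : body R d -> R)
    (hPhi : hitting_functional Phi) (hSigma : size_functional Sigma)
    (ha : 0 < a) (hne : superlevel Sigma a !=set0)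
    (htheta : deviation_functional Phi Sigma a theta) :
  exists f : R -> R,
    [/\ forall t : R, 0 <= t -> 0 <= f t <= 1,
        forall s t : R, 0 <= s -> s < t -> f s < f t,
        f 0 = 0,
        forall t : R, 0 < t -> 0 < f t &
        forall eps : R, 0 <= eps ->
          forall K, superlevel Sigma a K -> eps <= theta K ->
            (1 + f eps) * isoperimetric_constant Phi Sigma a <= Phi K].
Proof.
have [tau0 tau_le] := isoperimetric_constant_min hPhi hSigma ha hne.
have [Phic _ _] := hPhi; have [_ _ thetaE] := htheta.
set tau := isoperimetric_constant Phi Sigma a in tau0 tau_le *.
pose A t := superlevel Sigma a `&` [set K | t <= theta K].
pose g K := Phi K / tau - 1.
(* [g] is the relative excess of [Phi] over [tau]. The element [1] caps [m] and keeps [E t] nonempty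
   when [A t] is empty. *)
pose E t := [set 1] `|` [set g K | K in A t].
pose m t := inf (E t).
have g0 K : superlevel Sigma a K -> 0 <= g K.
  by move=> SK; rewrite subr_ge0 ler_pdivlMr// mul1r tau_le.
have Elb t : lbound (E t) 0.
  by move=> _ [->|[K [SK _] <-]]; [exact: ler01|exact: g0].
have m_le t y : E t y -> m t <= y.
  by move=> Ey; apply: ge_inf => //; exists 0; exact: Elb.
have m_ge t y : lbound (E t) y -> y <= m t.
  by apply: lb_le_inf; exists 1; left.
have m1 t : m t <= 1 by apply: m_le; left.
have m0 t : 0 <= m t by exact: m_ge.
have m_homo s t : s <= t -> m s <= m t.
  move=> st; apply: m_ge => _ [->|[K [SK tK] <-]]; first exact: m1.
  by apply: m_le; right; exists K => //; split => //; exact: le_trans tK.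
have m_gt0 (t : R) : 0 < t -> 0 < m t.
  move=> t0; have [A0|/set0P Ane] := eqVneq (A t) set0.
    by rewrite /m /E A0 image_set0 setU0 inf1 ltr01.
  have [K] := compact_EVT_min Ane (@deviation_ge_compact _ _ _ _ _ _ t hSigma htheta)
    (continuous_subspaceT Phic).
  rewrite inE => -[SK tK] Kmin.
  (* [theta K >= t > 0] rules out extremality, so [Phi K] differs from [tau]. *)
  have gK : 0 < g K.
    rewrite subr_gt0 ltr_pdivlMr// mul1r lt_neqAle tau_le// andbT eq_sym.
    apply/eqP => KE; have /(thetaE K SK) th0 : extremal_bodies Phi Sigma a K by [].
    by move: tK; rewrite /= th0 leNgt t0.
  have : 0 < Num.min 1 (g K) by rewrite lt_min ltr01.
  move=> /lt_le_trans; apply; apply: m_ge => _ [->|[L AL <-]].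
    by rewrite ge_min lexx.
  rewrite ge_min; apply/orP; right; rewrite lerD2r ler_pM2r ?invr_gt0//.
  by apply: Kmin; rewrite inE.
have s1 (s : R) : 0 <= s -> 0 < 1 + s by move=> s0; lra.
exists (fun t => m t * (t / (1 + t))); split.
- move=> t t0; have t1 : t / (1 + t) <= 1 by rewrite ler_pdivrMr ?s1//; lra.
  have t2 : 0 <= t / (1 + t) by rewrite divr_ge0// ltW// s1.
  by rewrite mulr_ge0//= mulr_ile1.
- move=> s t s0 st; have t0 := le_lt_trans s0 st.
  (* [m] may be constant on intervals, so strictness comes from the second factor, using
     [m t > 0]. *)
  apply: (@le_lt_trans _ _ (m t * (s / (1 + s)))).
    by rewrite ler_wpM2r ?divr_ge0 ?(ltW (s1 _ _))// m_homo// ltW.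
  rewrite ltr_pM2l ?m_gt0// ltr_pdivrMr ?s1// mulrAC ltr_pdivlMr ?s1 ?ltW//.
  by lra.
- by rewrite mul0r mulr0.
- by move=> t t0; rewrite mulr_gt0 ?m_gt0// divr_gt0// s1// ltW.
- move=> t t0 K SK tK; rewrite -ler_pdivlMr// addrC -lerBrDr.
  (* The factor [t / (1 + t)] is at most [1], and [m t <= g K] since [K] is in [A t]. *)
  apply: (@le_trans _ _ (m t)); last by apply: m_le; right; exists K.
  by rewrite ler_piMr// ler_pdivrMr ?s1//; lra.
Qed.
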